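(* The cut rule is eliminable from derivations in $LJ^{=}$ and in $LK^{=}$; that is, every sequent derivable in $LJ^{=}$ (respectively $LK^{=}$) has a derivation in $LJ^{=}$ (respectively $LK^{=}$) that does not use the cut rule.
   Context: The language is first-order with equality and function symbols; free and bound object variables are syntactically distinct, and terms contain only free variables. A sequent $\Gamma\Rightarrow\Delta$ consists of two finite sequences of formulae. $F\{v/t\}$ is the result of simultaneously replacing all occurrences of the free object variable $v$ in $F$ by the term $t$. $LK$ is Gentzen's classical sequent calculus: logical axioms $F\Rightarrow F$ for every formula $F$; the structural rules of left and right weakening, exchange and contraction, and the cut rule (from $\Gamma\Rightarrow\Delta,F$ and $\Lambda,F\Rightarrow\Theta$ infer $\Gamma,\Lambda\Rightarrow\Delta,\Theta$); and the usual left and right logical rules for $\neg,\wedge,\vee,\to,\forall,\exists$, where the left rule for $\forall$ and the right rule for $\exists$ may be instantiated with an arbitrary term. $LJ$ is Gentzen's intuitionistic calculus, in which all sequents have at most one formula in the succedent. $LJ^{=}$ and $LK^{=}$ are obtained from $LJ$ and $LK$ by adding the Reflexivity Axiom $\Rightarrow t=t$ (for every term $t$) and the rules $(=_1)$: from $\Gamma\Rightarrow\Delta,F\{v/r\}$ infer $\Gamma,r=s\Rightarrow\Delta,F\{v/s\}$; $(=_2)$: from $\Gamma\Rightarrow\Delta,F\{v/r\}$ infer $\Gamma,s=r\Rightarrow\Delta,F\{v/s\}$; where $F$ is any formula, $r,s$ are terms, $v$ is a free object variable occurring neither in $r$ nor in $s$, and, in the case of $LJ^{=}$, $\Delta=\emptyset$.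 *)

(* Defs.v *)
From Stdlib Require List.
From mathcomp Require Import all_boot.

Set Implicit Arguments.
Unset Strict Implicit.
Unset Printing Implicit Defensive.

Record signature := Signature {
  fsym : Type;
  farity : fsym -> nat;
  psym : Type;
  parity : psym -> nat
}.

(* Free variables are named by natural numbers, bound variables are de Bruijn
   indices: [semiterm L n] and [semiformula L n] may contain the [n] indices of
   enclosing quantifiers.  At [n = 0] no index is left dangling. *)

Inductive semiterm (L : signature) (n : nat) : Type :=
| FVar of nat
| BVar of 'I_n
| Fun (f : fsym L) of {ffun 'I_(farity f) -> semiterm L n}.

Arguments FVar {L n}.
Arguments BVar {L n}.
Arguments Fun {L n}.

Inductive semiformula (L : signature) (n : nat) : Type :=
| Pred (p : psym L) of {ffun 'I_(parity p) -> semiterm L n}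
| Eq of semiterm L n & semiterm L n
| Not of semiformula L n
| And of semiformula L n & semiformula L n
| Or of semiformula L n & semiformula L n
| Imp of semiformula L n & semiformula L n
| All of semiformula L n.+1
| Ex of semiformula L n.+1.

Arguments Pred {L n}.

Definition term (L : signature) := semiterm L 0.
Definition formula (L : signature) := semiformula L 0.

Fixpoint lift_term {L : signature} (n : nat) (t : term L) : semiterm L n :=
  match t with
  | FVar v => FVar v
  | BVar i => BVar (widen_ord (leq0n n) i)
  | Fun f ts => Fun f [ffun i => lift_term n (ts i)]
  end.

Fixpoint term_occurs {L : signature} {n : nat} (v : nat) (t : semiterm L n)
    : Prop :=
  match t with
  | FVar w => v = w
  | BVar _ => False
  | Fun f ts => exists i, term_occurs v (ts i)
  end.

Fixpoint occurs {L : signature} {n : nat} (v : nat) (F : semiformula L n)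
    : Prop :=
  match F with
  | Pred p ts => exists i, term_occurs v (ts i)
  | Eq r s => term_occurs v r \/ term_occurs v s
  | Not A => occurs v A
  | And A B | Or A B | Imp A B => occurs v A \/ occurs v B
  | All A | Ex A => occurs v A
  end.

Fixpoint term_subst {L : signature} {n : nat} (v : nat) (t : term L)
    (u : semiterm L n) : semiterm L n :=
  match u with
  | FVar w => if w == v then lift_term n t else FVar w
  | BVar i => BVar i
  | Fun f us => Fun f [ffun i => term_subst v t (us i)]
  end.

(* F{v/t}; no capture can occur, as [t] contains no bound variable. *)
Fixpoint subst {L : signature} {n : nat} (v : nat) (t : term L)
    (F : semiformula L n) : semiformula L n :=
  match F with
  | Pred p us => Pred p [ffun i => term_subst v t (us i)]
  | Eq r s => Eq (term_subst v t r) (term_subst v t s)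
  | Not A => Not (subst v t A)
  | And A B => And (subst v t A) (subst v t B)
  | Or A B => Or (subst v t A) (subst v t B)
  | Imp A B => Imp (subst v t A) (subst v t B)
  | All A => All (subst v t A)
  | Ex A => Ex (subst v t A)
  end.

(* [inst t A] replaces the outermost dangling index [ord_max] by [t]; for
   [A : semiformula L 1] it is the instance at [t] of [All A] and [Ex A].
   [unlift ord_max] leaves the values of the other indices unchanged. *)
Fixpoint term_inst {L : signature} {n : nat} (t : term L)
    (u : semiterm L n.+1) : semiterm L n :=
  match u with
  | FVar w => FVar w
  | BVar i => if unlift ord_max i is Some j then BVar j else lift_term n t
  | Fun f us => Fun f [ffun i => term_inst t (us i)]
  end.

Fixpoint inst {L : signature} {n : nat} (t : term L)
    (F : semiformula L n.+1) : semiformula L n :=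
  match F with
  | Pred p us => Pred p [ffun i => term_inst t (us i)]
  | Eq r s => Eq (term_inst t r) (term_inst t s)
  | Not A => Not (inst t A)
  | And A B => And (inst t A) (inst t B)
  | Or A B => Or (inst t A) (inst t B)
  | Imp A B => Imp (inst t A) (inst t B)
  | All A => All (inst t A)
  | Ex A => Ex (inst t A)
  end.

Record sequent (L : signature) := Sequent {
  ante : seq (formula L);
  succ : seq (formula L)
}.

Notation "G ==>> D" := (Sequent G D) (at level 90, no associativity).

Definition sequent_occurs {L : signature} (v : nat) (S : sequent L) : Prop :=
  exists F, List.In F (ante S ++ succ S) /\ occurs v F.

(* A rule is the set of its instances [R premises conclusion]; axioms are the
   instances without premises. *)
Definition rule (L : signature) := seq (sequent L) -> sequent L -> Prop.

Inductive structural_rule {L : signature} : rule L :=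
| WeakenL G D F :
    structural_rule [:: G ==>> D] (rcons G F ==>> D)
| WeakenR G D F :
    structural_rule [:: G ==>> D] (G ==>> rcons D F)
| ExchangeL G1 G2 D E F :
    structural_rule [:: G1 ++ E :: F :: G2 ==>> D] (G1 ++ F :: E :: G2 ==>> D)
| ExchangeR G D1 D2 E F :
    structural_rule [:: G ==>> D1 ++ E :: F :: D2] (G ==>> D1 ++ F :: E :: D2)
| ContractL G D F :
    structural_rule [:: rcons (rcons G F) F ==>> D] (rcons G F ==>> D)
| ContractR G D F :
    structural_rule [:: G ==>> rcons (rcons D F) F] (G ==>> rcons D F).

Inductive logical_rule {L : signature} : rule L :=
| Ax F :
    logical_rule [::] ([:: F] ==>> [:: F])
| NotL G D A :
    logical_rule [:: G ==>> rcons D A] (rcons G (Not A) ==>> D)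
| NotR G D A :
    logical_rule [:: rcons G A ==>> D] (G ==>> rcons D (Not A))
| AndL1 G D A B :
    logical_rule [:: rcons G A ==>> D] (rcons G (And A B) ==>> D)
| AndL2 G D A B :
    logical_rule [:: rcons G B ==>> D] (rcons G (And A B) ==>> D)
| AndR G D A B :
    logical_rule [:: G ==>> rcons D A; G ==>> rcons D B]
                 (G ==>> rcons D (And A B))
| OrL G D A B :
    logical_rule [:: rcons G A ==>> D; rcons G B ==>> D]
                 (rcons G (Or A B) ==>> D)
| OrR1 G D A B :
    logical_rule [:: G ==>> rcons D A] (G ==>> rcons D (Or A B))
| OrR2 G D A B :
    logical_rule [:: G ==>> rcons D B] (G ==>> rcons D (Or A B))
| ImpL G1 G2 D1 D2 A B :
    logical_rule [:: G1 ==>> rcons D1 A; rcons G2 B ==>> D2]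
                 (rcons (G1 ++ G2) (Imp A B) ==>> D1 ++ D2)
| ImpR G D A B :
    logical_rule [:: rcons G A ==>> rcons D B] (G ==>> rcons D (Imp A B))
| AllL G D (A : semiformula L 1) t :
    logical_rule [:: rcons G (inst t A) ==>> D] (rcons G (All A) ==>> D)
| AllR G D (A : semiformula L 1) a :
    ~ sequent_occurs a (G ==>> rcons D (All A)) ->
    logical_rule [:: G ==>> rcons D (inst (FVar a) A)] (G ==>> rcons D (All A))
| ExL G D (A : semiformula L 1) a :
    ~ sequent_occurs a (rcons G (Ex A) ==>> D) ->
    logical_rule [:: rcons G (inst (FVar a) A) ==>> D] (rcons G (Ex A) ==>> D)
| ExR G D (A : semiformula L 1) t :
    logical_rule [:: G ==>> rcons D (inst t A)] (G ==>> rcons D (Ex A)).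

Inductive cut_rule {L : signature} : rule L :=
| Cut G1 G2 D1 D2 F :
    cut_rule [:: G1 ==>> rcons D1 F; rcons G2 F ==>> D2]
             (G1 ++ G2 ==>> D1 ++ D2).

Inductive equality_rule {L : signature} : rule L :=
| EqRefl (t : term L) :
    equality_rule [::] ([::] ==>> [:: Eq t t])
| Eq1 G D (F : formula L) v r s :
    ~ term_occurs v r -> ~ term_occurs v s ->
    equality_rule [:: G ==>> rcons D (subst v r F)]
                  (rcons G (Eq r s) ==>> rcons D (subst v s F))
| Eq2 G D (F : formula L) v r s :
    ~ term_occurs v r -> ~ term_occurs v s ->
    equality_rule [:: G ==>> rcons D (subst v r F)]
                  (rcons G (Eq s r) ==>> rcons D (subst v s F)).

Definition cutfree_LKeq {L : signature} : rule L := fun Ps S =>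
  [\/ structural_rule Ps S, logical_rule Ps S | equality_rule Ps S].

Definition LKeq {L : signature} : rule L := fun Ps S =>
  cutfree_LKeq Ps S \/ cut_rule Ps S.

(* At most one formula in every succedent; in [Eq1] and [Eq2] this amounts to
   [D = [::]]. *)
Definition intuitionistic {L : signature} (R : rule L) : rule L := fun Ps S =>
  R Ps S /\ forall T, List.In T (S :: Ps) -> size (succ T) <= 1.

Definition cutfree_LJeq {L : signature} : rule L := intuitionistic cutfree_LKeq.

Definition LJeq {L : signature} : rule L := intuitionistic LKeq.

Inductive derivable {L : signature} (R : rule L) : sequent L -> Prop :=
| Derive Ps S :
    R Ps S -> (forall P, List.In P Ps -> derivable R P) -> derivable R S.

(* Main.v *)
Require Import Defs.
From Stdlib Require List Permutation.
From mathcomp Require Import all_boot.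

Set Implicit Arguments.
Unset Strict Implicit.
Unset Printing Implicit Defensive.

(** Both calculi are compared with one auxiliary calculus [prov lj], cut-free
    and infinitary, in which cut is admissible; [lj] selects the intuitionistic
    version.  Derivations with cut are sent into it ([prov_of_derivable]), with
    [prov_cut] used at every cut, and its proofs are read back as cut-free
    derivations ([derivable_of_prov]).

    The auxiliary calculus is chosen so that the usual bureaucracy disappears.
    Contexts are read as sets, so there is nothing left of the structural rules
    but monotonicity ([prov_incl]).  The right rule of the universal quantifier
    and the left rule of the existential one have a premise for every term in
    place of an eigenvariable, so cutting a quantified formula needs no
    substitution into proofs: the substitutions are made once and for all on
    entering the calculus, and one fresh variable is chosen on leaving it.  The
    equality rules become: from [A] infer [B] if [r = s] or [s = r] is in the
    antecedent and [B] results from [A] by replacing some occurrences of [r] by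
    [s].  The two logics differ only in the formulae that accompany the active
    formula in the succedent of a premise: all of them, or none ([side]).

    The heart of the matter is what happens to an equality rule above a cut.
    Suppose that the cut formula [B] was obtained on the left of the cut from
    [A] by means of [r = s].  The other premise of the cut, with [B] in its
    antecedent, is also provable with [A] there ([prov_repl]), and so the cut on
    [B] becomes a cut on [A], which has the same logical complexity and a
    shorter left proof.  To prove [prov_repl] one follows the formula up the
    proof.  If it ends in an axiom [A => A], replacing the left copy is
    repaired by an equality rule on the right.  If it is an equality [p = q]
    that an equality rule uses to pass from [C] to [D], and it has become
    [p' = q'], then that step is replaced by three: from [C] to [C'] by [r = s],
    from [C'] to [D'] by [p' = q'], and back from [D'] to [D] by [r = s]
    ([repl_square]).  That [Eq1] and [Eq2] apply to every formula, and in
    both directions, is what closes the argument.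

    The rest is Gentzen's double induction: on the number of connectives of the
    cut formula, then on the left proof ([cut_set]) until the cut formula is
    introduced there by a right rule, and then on the right proof
    ([cut_principal]).  An equality can only be introduced on the left by
    reflexivity [t = t], and then it is useless in the antecedent of the right
    proof, since replacing [t] by [t] changes nothing. *)

(** * Induction and choice *)

(** The generated principle gives no induction hypothesis for the arguments of
    a function symbol, which are nested in a finite function. *)
Lemma semiterm_induction (L : signature) n (P : semiterm L n -> Prop) :
  (forall v, P (FVar v)) -> (forall i, P (BVar i)) ->
  (forall f (ts : {ffun 'I_(farity f) -> semiterm L n}),
     (forall i, P (ts i)) -> P (Fun f ts)) -> forall u, P u.
Proof.
move=> PV PB PF; fix IH 1; case=> [v|i|f ts]; [exact: PV|exact: PB|].
exact: PF (fun i => IH (ts i)).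
Qed.

Lemma ffun_choice (I : finType) T (P : I -> T -> Prop) :
  (forall i, exists x, P i x) -> exists f : {ffun I -> T}, forall i, P i (f i).
Proof.
case/fin_all_exists=> f Pf; exists [ffun i => f i] => i; by rewrite ffunE.
Qed.

Lemma ffun_choice2 (I : finType) T (P : I -> T -> T -> Prop) :
  (forall i, exists x y, P i x y) ->
  exists f g : {ffun I -> T}, forall i, P i (f i) (g i).
Proof.
move=> H; have [|h Ph] := @ffun_choice I (T * T) (fun i z => P i z.1 z.2).
  by move=> i; have [x [y Pxy]] := H i; exists (x, y).
by exists [ffun i => (h i).1], [ffun i => (h i).2] => i; rewrite !ffunE.
Qed.

(** * Instances and substitutions *)

Lemma lift_term0 (L : signature) (t : term L) : lift_term 0 t = t.
Proof.
elim/semiterm_induction: t => //= [[]//|f ts IH].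
by congr Fun; apply/ffunP=> i; rewrite ffunE.
Qed.

Lemma term_inst_lift (L : signature) n (t u : term L) :
  term_inst t (lift_term n.+1 u) = lift_term n u.
Proof.
elim/semiterm_induction: u => //= [[]//|f ts IH].
by congr Fun; apply/ffunP=> i; rewrite !ffunE.
Qed.

(** Simultaneous substitution, in contrast with [term_subst] and [subst]:
    changing its value at an eigenvariable is then again a substitution. *)
Fixpoint tsub {L : signature} {n : nat} (sg : nat -> term L)
    (u : semiterm L n) : semiterm L n :=
  match u with
  | FVar w => lift_term n (sg w)
  | BVar i => BVar i
  | Fun f us => Fun f [ffun i => tsub sg (us i)]
  end.

Fixpoint fsub {L : signature} {n : nat} (sg : nat -> term L)
    (F : semiformula L n) : semiformula L n :=
  match F with
  | Pred p us => Pred p [ffun i => tsub sg (us i)]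
  | Eq r s => Eq (tsub sg r) (tsub sg s)
  | Not A => Not (fsub sg A)
  | And A B => And (fsub sg A) (fsub sg B)
  | Or A B => Or (fsub sg A) (fsub sg B)
  | Imp A B => Imp (fsub sg A) (fsub sg B)
  | All A => All (fsub sg A)
  | Ex A => Ex (fsub sg A)
  end.

Lemma tsub_id (L : signature) n (u : semiterm L n) : tsub FVar u = u.
Proof.
elim/semiterm_induction: u => //= f us IH.
by congr Fun; apply/ffunP=> i; rewrite ffunE.
Qed.

Lemma fsub_id (L : signature) n (F : semiformula L n) : fsub FVar F = F.
Proof.
elim: F => {n} //=.
- by move=> n p us; congr Pred; apply/ffunP=> i; rewrite ffunE tsub_id.
- by move=> n r s; rewrite !tsub_id.
- by move=> n A ->.
- by move=> n A -> B ->.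
- by move=> n A -> B ->.
- by move=> n A -> B ->.
- by move=> n A ->.
- by move=> n A ->.
Qed.

Lemma tsub_ext (L : signature) n (u : semiterm L n) sg tau :
  (forall v, term_occurs v u -> sg v = tau v) -> tsub sg u = tsub tau u.
Proof.
elim/semiterm_induction: u => //= [v H|f us IH H]; first by rewrite H.
congr Fun; apply/ffunP=> i; rewrite !ffunE; apply: IH => v Hv.
by apply: H; exists i.
Qed.

Lemma fsub_ext (L : signature) n (F : semiformula L n) sg tau :
  (forall v, occurs v F -> sg v = tau v) -> fsub sg F = fsub tau F.
Proof.
elim: F => {n} /=.
- move=> n p us H; congr Pred; apply/ffunP=> i; rewrite !ffunE.
  by apply: tsub_ext => v Hv; apply: H; exists i.
- by move=> n r s H; congr Eq; apply: tsub_ext => v Hv; apply: H; tauto.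
- by move=> n A IH H; rewrite IH.
- by move=> n A IHA B IHB H; rewrite IHA ?IHB // => v Hv; apply: H; tauto.
- by move=> n A IHA B IHB H; rewrite IHA ?IHB // => v Hv; apply: H; tauto.
- by move=> n A IHA B IHB H; rewrite IHA ?IHB // => v Hv; apply: H; tauto.
- by move=> n A IH H; rewrite IH.
- by move=> n A IH H; rewrite IH.
Qed.

Lemma tsub_lift (L : signature) n (t : term L) sg :
  tsub sg (lift_term n t) = lift_term n (tsub sg t).
Proof.
elim/semiterm_induction: t => /= [v|[]//|f ts IH]; first by rewrite lift_term0.
by congr Fun; apply/ffunP=> i; rewrite !ffunE.
Qed.

Lemma tsub_inst (L : signature) n (t : term L) (u : semiterm L n.+1) sg :
  tsub sg (term_inst t u) = term_inst (tsub sg t) (tsub sg u).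
Proof.
elim/semiterm_induction: u => /= [v|i|f us IH]; first by rewrite term_inst_lift.
  by case: unlift => //=; rewrite tsub_lift.
by congr Fun; apply/ffunP=> i; rewrite !ffunE.
Qed.

(** [inst] is defined at positive indices only, where the generated induction
    principle does not apply as it stands. *)
Lemma semiformula_S_induction (L : signature)
    (P : forall n, semiformula L n.+1 -> Prop) :
  (forall n p us, P n (Pred p us)) -> (forall n r s, P n (Eq r s)) ->
  (forall n A, P n A -> P n (Not A)) ->
  (forall n A B, P n A -> P n B -> P n (And A B)) ->
  (forall n A B, P n A -> P n B -> P n (Or A B)) ->
  (forall n A B, P n A -> P n B -> P n (Imp A B)) ->
  (forall n A, P n.+1 A -> P n (All A)) ->
  (forall n A, P n.+1 A -> P n (Ex A)) ->
  forall n F, P n F.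
Proof.
move=> HP HE HN HA HO HI HAl HEx.
suff H m (F : semiformula L m) :
    match m return semiformula L m -> Prop with
    | 0 => fun=> True | n.+1 => P n end F by move=> n F; exact: (H n.+1 F).
by elim: F => {m} [] [|n] *; eauto.
Qed.

Lemma fsub_inst (L : signature) n (t : term L) (F : semiformula L n.+1) sg :
  fsub sg (inst t F) = inst (tsub sg t) (fsub sg F).
Proof.
elim/semiformula_S_induction: n / F => /=.
- by move=> n p us; congr Pred; apply/ffunP=> i; rewrite !ffunE tsub_inst.
- by move=> n r s; rewrite !tsub_inst.
- by move=> n A ->.
- by move=> n A B -> ->.
- by move=> n A B -> ->.
- by move=> n A B -> ->.
- by move=> n A ->.
- by move=> n A ->.
Qed.

Fixpoint csize {L : signature} {n : nat} (F : semiformula L n) : nat :=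
  match F with
  | Pred _ _ | Eq _ _ => 0
  | Not A | All A | Ex A => (csize A).+1
  | And A B | Or A B | Imp A B => (csize A + csize B).+1
  end.

Lemma csize_inst (L : signature) n (t : term L) (F : semiformula L n.+1) :
  csize (inst t F) = csize F.
Proof. by elim/semiformula_S_induction: n / F => //= n A B; congruence. Qed.

Lemma term_bound (L : signature) n (u : semiterm L n) :
  exists N, forall v, term_occurs v u -> v < N.
Proof.
elim/semiterm_induction: u => /= [w|i|f us /fin_all_exists[N HN]].
- by exists w.+1 => v ->.
- by exists 0.
- exists (\max_i N i) => v [i /HN Hv]; exact: leq_trans Hv (leq_bigmax i).
Qed.

Lemma formula_bound (L : signature) n (F : semiformula L n) :
  exists N, forall v, occurs v F -> v < N.
Proof.
elim: F => {n} //=.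
- move=> n p us.
  have /fin_all_exists[N HN] := fun i => term_bound (us i).
  exists (\max_i N i) => v [i /HN Hv]; exact: leq_trans Hv (leq_bigmax i).
- move=> n r s; have [[N HN] [M HM]] := (term_bound r, term_bound s).
  by exists (maxn N M) => v [/HN|/HM]; rewrite leq_max => -> //; rewrite orbT.
- move=> n A [N HN] B [M HM].
  by exists (maxn N M) => v [/HN|/HM]; rewrite leq_max => -> //; rewrite orbT.
- move=> n A [N HN] B [M HM].
  by exists (maxn N M) => v [/HN|/HM]; rewrite leq_max => -> //; rewrite orbT.
- move=> n A [N HN] B [M HM].
  by exists (maxn N M) => v [/HN|/HM]; rewrite leq_max => -> //; rewrite orbT.
Qed.

Lemma list_bound (L : signature) (l : seq (formula L)) :
  exists N, forall F v, List.In F l -> occurs v F -> v < N.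
Proof.
elim: l => [|A l [N HN]] /=; first by exists 0.
have [M HM] := formula_bound A; exists (maxn N M) => F v.
by case=> [<- /HM|/HN H /H]; rewrite leq_max => -> //; rewrite orbT.
Qed.

(** * Replacing equals by equals *)

(** The occurrences of [r] that are replaced are chosen freely, as they are by
    the marking variable of [Eq1] and [Eq2].  With a relation there is no such
    variable to be kept distinct from those of an instantiating term. *)
Inductive trepl {L : signature} (r s : term L) {n : nat} :
    semiterm L n -> semiterm L n -> Prop :=
| TreplHere : trepl r s (lift_term n r) (lift_term n s)
| TreplFVar v : trepl r s (FVar v) (FVar v)
| TreplBVar i : trepl r s (BVar i) (BVar i)
| TreplFun f (us ws : {ffun 'I_(farity f) -> semiterm L n}) :
    (forall i, trepl r s (us i) (ws i)) -> trepl r s (Fun f us) (Fun f ws).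

(** By recursion on [F], so that a hypothesis on a compound formula reduces to
    hypotheses on its parts. *)
Fixpoint repl {L : signature} {n : nat} (r s : term L) (F G : semiformula L n)
    : Prop :=
  match F with
  | Pred p us => exists ws, G = Pred p ws /\ forall i, trepl r s (us i) (ws i)
  | Eq a b => exists a' b', [/\ G = Eq a' b', trepl r s a a' & trepl r s b b']
  | Not A => exists A', G = Not A' /\ repl r s A A'
  | And A B =>
      exists A' B', [/\ G = And A' B', repl r s A A' & repl r s B B']
  | Or A B => exists A' B', [/\ G = Or A' B', repl r s A A' & repl r s B B']
  | Imp A B =>
      exists A' B', [/\ G = Imp A' B', repl r s A A' & repl r s B B']
  | All A => exists A', G = All A' /\ repl r s A A'
  | Ex A => exists A', G = Ex A' /\ repl r s A A'
  end.

Lemma trepl_refl (L : signature) n r s (u : semiterm L n) : trepl r s u u.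
Proof.
by elim/semiterm_induction: u => [v|i|f us IH]; constructor.
Qed.

Lemma repl_refl (L : signature) n r s (F : semiformula L n) : repl r s F F.
Proof.
elim: F => {n} /=.
- by move=> n p us; exists us; split=> // i; exact: trepl_refl.
- by move=> n a b; exists a, b; split=> //; exact: trepl_refl.
- by move=> n A IH; exists A.
- by move=> n A IHA B IHB; exists A, B.
- by move=> n A IHA B IHB; exists A, B.
- by move=> n A IHA B IHB; exists A, B.
- by move=> n A IH; exists A.
- by move=> n A IH; exists A.
Qed.

Lemma trepl_sym (L : signature) n r s (u w : semiterm L n) :
  trepl r s u w -> trepl s r w u.
Proof. by elim=> *; constructor. Qed.

Lemma repl_sym (L : signature) n r s (F G : semiformula L n) :
  repl r s F G -> repl s r G F.
Proof.
elim: F G => {n} /=.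
- move=> n p us G [ws [-> H]]; exists us; split=> // i; exact: trepl_sym.
- by move=> n a b G [a' [b' [-> /trepl_sym ? /trepl_sym ?]]]; exists a, b.
- by move=> n A IH G [A' [-> /IH ?]]; exists A.
- by move=> n A IHA B IHB G [A' [B' [-> /IHA ? /IHB ?]]]; exists A, B.
- by move=> n A IHA B IHB G [A' [B' [-> /IHA ? /IHB ?]]]; exists A, B.
- by move=> n A IHA B IHB G [A' [B' [-> /IHA ? /IHB ?]]]; exists A, B.
- by move=> n A IH G [A' [-> /IH ?]]; exists A.
- by move=> n A IH G [A' [-> /IH ?]]; exists A.
Qed.

Lemma csize_repl (L : signature) n r s (F G : semiformula L n) :
  repl r s F G -> csize G = csize F.
Proof.
elim: F G => {n} /=.
- by move=> n p us G [ws [->]].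
- by move=> n a b G [a' [b' [->]]].
- by move=> n A IH G [A' [-> /IH /= ->]].
- by move=> n A IHA B IHB G [A' [B' [-> /IHA /= -> /IHB ->]]].
- by move=> n A IHA B IHB G [A' [B' [-> /IHA /= -> /IHB ->]]].
- by move=> n A IHA B IHB G [A' [B' [-> /IHA /= -> /IHB ->]]].
- by move=> n A IH G [A' [-> /IH /= ->]].
- by move=> n A IH G [A' [-> /IH /= ->]].
Qed.

Lemma trepl_id (L : signature) n t (u w : semiterm L n) :
  trepl t t u w -> u = w.
Proof. by elim=> // f us ws _ IH; congr Fun; apply/ffunP. Qed.

Lemma repl_id (L : signature) n t (F G : semiformula L n) :
  repl t t F G -> F = G.
Proof.
elim: F G => {n} /=.
- move=> n p us G [ws [-> H]]; congr Pred; apply/ffunP=> i;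
  exact: trepl_id (H i).
- by move=> n a b G [a' [b' [-> /trepl_id -> /trepl_id ->]]].
- by move=> n A IH G [A' [-> /IH ->]].
- by move=> n A IHA B IHB G [A' [B' [-> /IHA -> /IHB ->]]].
- by move=> n A IHA B IHB G [A' [B' [-> /IHA -> /IHB ->]]].
- by move=> n A IHA B IHB G [A' [B' [-> /IHA -> /IHB ->]]].
- by move=> n A IH G [A' [-> /IH ->]].
- by move=> n A IH G [A' [-> /IH ->]].
Qed.

Lemma trepl_inst (L : signature) n r s (t : term L) (u w : semiterm L n.+1) :
  trepl r s u w -> trepl r s (term_inst t u) (term_inst t w).
Proof.
elim=> [|v|i|f us ws _ IH] /=.
- by rewrite !term_inst_lift; constructor.
- by constructor.
- exact: trepl_refl.
- by constructor=> i; rewrite !ffunE.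
Qed.

Lemma repl_inst (L : signature) n r s (t : term L) (F G : semiformula L n.+1) :
  repl r s F G -> repl r s (inst t F) (inst t G).
Proof.
elim/semiformula_S_induction: n / F G => /=.
- move=> n p us G [ws [-> H]];
  exists [ffun i => term_inst t (ws i)]; split=> // i.
  by rewrite !ffunE; exact: trepl_inst.
- move=> n a b G [a' [b' [-> Ha Hb]]]; do 2!eexists.
  by split; [reflexivity|exact: trepl_inst..].
- by move=> n A IH G [A' [-> /IH ?]]; eexists.
- by move=> n A B IHA IHB G [A' [B' [-> /IHA ? /IHB ?]]]; do 2!eexists.
- by move=> n A B IHA IHB G [A' [B' [-> /IHA ? /IHB ?]]]; do 2!eexists.
- by move=> n A B IHA IHB G [A' [B' [-> /IHA ? /IHB ?]]]; do 2!eexists.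
- by move=> n A IH G [A' [-> /IH ?]]; eexists.
- by move=> n A IH G [A' [-> /IH ?]]; eexists.
Qed.

Lemma trepl_lift (L : signature) n r s (u w : term L) :
  trepl r s u w -> trepl r s (lift_term n u) (lift_term n w).
Proof.
elim=> [|v|[]//|f us ws _ IH] /=; rewrite ?lift_term0; constructor=> // i.
by rewrite !ffunE.
Qed.

Lemma trepl_square (L : signature) n (r s p q p' q' : term L)
    (u w : semiterm L n) :
  trepl r s p p' -> trepl r s q q' -> trepl p q u w ->
  exists u' w', [/\ trepl r s u u', trepl p' q' u' w' & trepl r s w w'].
Proof.
move=> Hp Hq; elim=> [|v|i|f us ws _ IH].
- exists (lift_term n p'), (lift_term n q').
  by split; [exact: trepl_lift|constructor|exact: trepl_lift].
- by exists (FVar v), (FVar v); split; constructor.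
- by exists (BVar i), (BVar i); split; constructor.
- have [us' [ws' H]] := ffun_choice2 IH.
  by exists (Fun f us'), (Fun f ws'); split; constructor=> i; case: (H i).
Qed.

(** If [p = q] turns [F] into [G], then after its sides have been changed to
    [p'] and [q'] by means of [r = s], it still does so up to two replacements
    by [r = s]: put [p'] and [q'] where [p] was replaced by [q]. *)
Lemma repl_square (L : signature) n (r s p q p' q' : term L)
    (F G : semiformula L n) :
  trepl r s p p' -> trepl r s q q' -> repl p q F G ->
  exists F' G', [/\ repl r s F F', repl p' q' F' G' & repl r s G G'].
Proof.
move=> Hp Hq; elim: F G => {n} /=.
- move=> n P us G [ws [-> H]].
  have [us' [ws' H']] := ffun_choice2 (fun i => trepl_square Hp Hq (H i)).
  exists (Pred P us'), (Pred P ws'); split.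
  + by exists us'; split=> // i; case: (H' i).
  + by exists ws'; split=> // i; case: (H' i).
  + by exists ws'; split=> // i; case: (H' i).
- move=> n a b G [a' [b' [-> Ha Hb]]].
  have [a1 [a2 [? ? ?]]] := trepl_square Hp Hq Ha.
  have [b1 [b2 [? ? ?]]] := trepl_square Hp Hq Hb.
  by exists (Eq a1 b1), (Eq a2 b2); split; do 2!eexists.
- move=> n A IH G [A' [-> /IH[A1 [A2 [? ? ?]]]]].
  by exists (Not A1), (Not A2); split; eexists.
- move=> n A IHA B IHB G [A' [B' [-> /IHA[A1 [A2 [? ? ?]]]]]].
  case/IHB=> B1 [B2 [? ? ?]].
  by exists (And A1 B1), (And A2 B2); split; do 2!eexists.
- move=> n A IHA B IHB G [A' [B' [-> /IHA[A1 [A2 [? ? ?]]]]]].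
  case/IHB=> B1 [B2 [? ? ?]].
  by exists (Or A1 B1), (Or A2 B2); split; do 2!eexists.
- move=> n A IHA B IHB G [A' [B' [-> /IHA[A1 [A2 [? ? ?]]]]]].
  case/IHB=> B1 [B2 [? ? ?]].
  by exists (Imp A1 B1), (Imp A2 B2); split; do 2!eexists.
- move=> n A IH G [A' [-> /IH[A1 [A2 [? ? ?]]]]].
  by exists (All A1), (All A2); split; eexists.
- move=> n A IH G [A' [-> /IH[A1 [A2 [? ? ?]]]]].
  by exists (Ex A1), (Ex A2); split; eexists.
Qed.

Lemma trepl_subst (L : signature) n v (r s : term L) (u : semiterm L n) sg :
  trepl (tsub sg r) (tsub sg s)
    (tsub sg (term_subst v r u)) (tsub sg (term_subst v s u)).
Proof.
elim/semiterm_induction: u => [w|i|f us IH] /=.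
- case: ifP => _; last exact: trepl_refl.
  by rewrite !tsub_lift; constructor.
- by constructor.
- by constructor=> i; rewrite !ffunE.
Qed.

(** Conversely, instances of [Eq1] and [Eq2] are replacements, and remain so
    after any substitution. *)
Lemma repl_subst (L : signature) n v (r s : term L) (F : semiformula L n) sg :
  repl (tsub sg r) (tsub sg s)
    (fsub sg (subst v r F)) (fsub sg (subst v s F)).
Proof.
elim: F => {n} /=.
- move=> n p us; eexists; split; first by [].
  by move=> i; rewrite !ffunE; exact: trepl_subst.
- by move=> *; do 2!eexists; split; first reflexivity; exact: trepl_subst.
- by move=> *; eexists.
- by move=> *; do 2!eexists.
- by move=> *; do 2!eexists.
- by move=> *; do 2!eexists.
- by move=> *; eexists.
- by move=> *; eexists.
Qed.

Lemma trepl_abstract (L : signature) n v (r s : term L) (u w : semiterm L n) :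
  trepl r s u w -> ~ term_occurs v u ->
  exists c, u = term_subst v r c /\ w = term_subst v s c.
Proof.
elim=> [|x|i|f us ws _ IH] /= Hv.
- by exists (FVar v); rewrite /= eqxx.
- by exists (FVar x) => /=; case: eqP Hv => [->|].
- by exists (BVar i).
- have [|cs Hcs] := @ffun_choice _ _
    (fun i c => us i = term_subst v r c /\ ws i = term_subst v s c).
    by move=> i; apply: IH => Hi; apply: Hv; exists i.
  exists (Fun f cs); split=> /=; congr Fun; apply/ffunP=> i; rewrite ffunE;
    by case: (Hcs i).
Qed.

(** The marked formula required by [Eq1] and [Eq2]; freshness of [v] keeps it
    distinct from the variables that were there before. *)
Lemma repl_abstract (L : signature) n v (r s : term L) (F G : semiformula L n) :
  repl r s F G -> ~ occurs v F ->
  exists C, F = subst v r C /\ G = subst v s C.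
Proof.
elim: F G => {n} /=.
- move=> n p us G [ws [-> H]] Hv.
  have [|cs Hcs] := @ffun_choice _ _
    (fun i c => us i = term_subst v r c /\ ws i = term_subst v s c).
    by move=> i; apply: trepl_abstract => // Hi; apply: Hv; exists i.
  exists (Pred p cs); split=> /=; congr Pred; apply/ffunP=> i; rewrite ffunE;
    by case: (Hcs i).
- move=> n a b G [a' [b' [-> Ha Hb]]] Hv.
  have [|c [-> ->]] := trepl_abstract (v := v) Ha; first tauto.
  have [|d [-> ->]] := trepl_abstract (v := v) Hb; first tauto.
  by exists (Eq c d).
- by move=> n A IH G [A' [-> /IH H /H[C [-> ->]]]]; exists (Not C).
- move=> n A IHA B IHB G [A' [B' [-> /IHA HA /IHB HB]]] Hv.
  have [|C [-> ->]] := HA; first tauto.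
  have [|D [-> ->]] := HB; first tauto.
  by exists (And C D).
- move=> n A IHA B IHB G [A' [B' [-> /IHA HA /IHB HB]]] Hv.
  have [|C [-> ->]] := HA; first tauto.
  have [|D [-> ->]] := HB; first tauto.
  by exists (Or C D).
- move=> n A IHA B IHB G [A' [B' [-> /IHA HA /IHB HB]]] Hv.
  have [|C [-> ->]] := HA; first tauto.
  have [|D [-> ->]] := HB; first tauto.
  by exists (Imp C D).
- by move=> n A IH G [A' [-> /IH H /H[C [-> ->]]]]; exists (All C).
- by move=> n A IH G [A' [-> /IH H /H[C [-> ->]]]]; exists (Ex C).
Qed.

(** * An infinitary calculus on sets of formulae *)

(** The part of a succedent that may accompany the active formula of a premise.
    In the intuitionistic case the premises formed with it have at most one
    succedent formula, and the other premises keep the succedent of the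
    conclusion; so a proof of a sequent with at most one succedent formula
    consists of such sequents. *)
Definition side {T : Type} (lj : bool) (D : seq T) : seq T :=
  if lj then [::] else D.

Definition has_eq {L : signature} (G : seq (formula L)) (r s : term L) : Prop :=
  List.In (Eq r s) G \/ List.In (Eq s r) G.

Inductive prov {L : signature} (lj : bool) :
    seq (formula L) -> seq (formula L) -> Prop :=
| PAx G D F : List.In F G -> List.In F D -> prov lj G D
| PNotL G D A :
    List.In (Not A) G -> prov lj G (A :: side lj D) -> prov lj G D
| PNotR G D A :
    List.In (Not A) D -> prov lj (A :: G) (side lj D) -> prov lj G D
| PAndL1 G D A B : List.In (And A B) G -> prov lj (A :: G) D -> prov lj G D
| PAndL2 G D A B : List.In (And A B) G -> prov lj (B :: G) D -> prov lj G D
| PAndR G D A B :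
    List.In (And A B) D -> prov lj G (A :: side lj D) ->
    prov lj G (B :: side lj D) -> prov lj G D
| POrL G D A B :
    List.In (Or A B) G -> prov lj (A :: G) D -> prov lj (B :: G) D ->
    prov lj G D
| POrR1 G D A B :
    List.In (Or A B) D -> prov lj G (A :: side lj D) -> prov lj G D
| POrR2 G D A B :
    List.In (Or A B) D -> prov lj G (B :: side lj D) -> prov lj G D
| PImpL G D A B :
    List.In (Imp A B) G -> prov lj G (A :: side lj D) -> prov lj (B :: G) D ->
    prov lj G D
| PImpR G D A B :
    List.In (Imp A B) D -> prov lj (A :: G) (B :: side lj D) -> prov lj G D
| PAllL G D A t :
    List.In (All A) G -> prov lj (inst t A :: G) D -> prov lj G D
| PAllR G D A :
    List.In (All A) D -> (forall t, prov lj G (inst t A :: side lj D)) ->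
    prov lj G D
| PExL G D A :
    List.In (Ex A) G -> (forall t, prov lj (inst t A :: G) D) -> prov lj G D
| PExR G D A t :
    List.In (Ex A) D -> prov lj G (inst t A :: side lj D) -> prov lj G D
| PRefl G D t : List.In (Eq t t) D -> prov lj G D
| PEq G D r s A B :
    has_eq G r s -> repl r s A B -> List.In B D ->
    prov lj G (A :: side lj D) -> prov lj G D.

Lemma incl_cons2 T (x : T) G D :
  List.incl G D -> List.incl (x :: G) (x :: D).
Proof. by move=> H y /= [|/H]; [left|right]. Qed.

Lemma incl_consr T (x : T) G D : List.incl G D -> List.incl G (x :: D).
Proof. by move=> H y /H; right. Qed.

Lemma incl_consl T (x : T) G D :
  List.In x D -> List.incl G D -> List.incl (x :: G) D.
Proof. by move=> Hx H y /= [<-|/H]. Qed.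

Lemma incl_side2 T lj (D E : seq T) :
  List.incl D E -> List.incl (side lj D) (side lj E).
Proof. by case: lj => //= _ x []. Qed.

Lemma incl_sidel T lj (D E : seq T) : List.incl D E -> List.incl (side lj D) E.
Proof. by case: lj => // _ x []. Qed.

Lemma incl_side_cons T lj (x : T) (D E : seq T) :
  List.incl (side lj D) (side lj E) ->
  List.incl (side lj D) (side lj (x :: E)).
Proof. by case: lj => [_ y []|] //= H; exact: incl_consr. Qed.

Lemma incl_side_side T lj (D E : seq T) :
  List.incl (side lj D) (side lj E) ->
  List.incl (side lj D) (side lj (side lj E)).
Proof. by case: lj => //= _ x []. Qed.

Lemma incl_swap T (x y : T) G P :
  List.incl G (y :: P) -> List.incl (x :: G) (y :: x :: P).
Proof. by move=> H z /= [<-|/H /= [<-|]]; auto. Qed.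

#[local] Hint Resolve List.incl_refl incl_cons2 incl_swap incl_consr incl_side2
  incl_sidel incl_side_cons incl_side_side List.in_eq List.in_cons : incl.

Lemma has_eq_incl (L : signature) (G G' : seq (formula L)) r s :
  List.incl G G' -> has_eq G r s -> has_eq G' r s.
Proof. by move=> HG [/HG|/HG]; [left|right]. Qed.
#[local] Hint Resolve has_eq_incl : incl.

(** Weakening, exchange and contraction at once. *)
Lemma prov_incl (L : signature) lj (G D G' D' : seq (formula L)) :
  prov lj G D -> List.incl G G' -> List.incl D D' -> prov lj G' D'.
Proof.
move=> H; elim: H G' D' => {G D}.
all: try by move=> *; econstructor; eauto with incl.
Qed.

(** The whole antecedent is rewritten at once, so that the induction goes
    through the rules that add formulae to it. *)
Lemma prov_repl (L : signature) lj (G D P : seq (formula L)) r s :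
  prov lj G D -> has_eq P r s ->
  (forall X, List.In X G -> exists Y, List.In Y P /\ repl r s X Y) ->
  prov lj P D.
Proof.
have ext A A' G0 P0 : repl r s A A' ->
    (forall X, List.In X G0 -> exists Y, List.In Y P0 /\ repl r s X Y) ->
    forall X, List.In X (A :: G0) ->
    exists Y, List.In Y (A' :: P0) /\ repl r s X Y.
  move=> HA H X /= [<-|/H[Y [HY HX]]]; first by exists A'; split=> //; left.
  by exists Y; split=> //; right.
have hcons A P0 : has_eq P0 r s -> has_eq (A :: P0) r s.
  by apply: has_eq_incl; exact: incl_consr.
move=> H; elim: H P => {G D}.
- move=> G D F HG HD P e /(_ _ HG) [Y [HY HF]].
  (* prove the rewritten formula, then rewrite it back in the succedent *)
  apply: (PEq (r := s) (s := r) (A := Y) _ _ HD).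
  + by case: e; [right|left].
  + exact: repl_sym.
  + by apply: PAx HY _; left.
- move=> G D A HG _ IH P e HP; have [Y [HY /= [A' [EY HA]]]] := HP _ HG.
  rewrite EY in HY; apply: (PNotL HY).
  (* the premise proves A, but the left rule for ~ A' needs A' *)
  apply: (PEq e HA (B := A')); first by left.
  by apply: prov_incl (IH P e HP) _ _; auto 10 with incl.
- move=> G D A HD _ IH P e HP; apply: (PNotR HD).
  by apply: IH; auto; apply: ext => //; exact: repl_refl.
- move=> G D A B HG _ IH P e HP.
  have [Y [HY /= [A' [B' [EY HA HB]]]]] := HP _ HG.
  by rewrite EY in HY; apply: (PAndL1 HY); apply: IH; auto; apply: ext.
- move=> G D A B HG _ IH P e HP.
  have [Y [HY /= [A' [B' [EY HA HB]]]]] := HP _ HG.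
  by rewrite EY in HY; apply: (PAndL2 HY); apply: IH; auto; apply: ext.
- by move=> G D A B HD _ IHA _ IHB P e HP; apply: (PAndR HD); auto.
- move=> G D A B HG _ IHA _ IHB P e HP.
  have [Y [HY /= [A' [B' [EY HA HB]]]]] := HP _ HG.
  rewrite EY in HY; apply: (POrL HY).
    by apply: IHA; auto; apply: ext.
  by apply: IHB; auto; apply: ext.
- by move=> G D A B HD _ IH P e HP; apply: (POrR1 HD); auto.
- by move=> G D A B HD _ IH P e HP; apply: (POrR2 HD); auto.
- move=> G D A B HG _ IHA _ IHB P e HP.
  have [Y [HY /= [A' [B' [EY HA HB]]]]] := HP _ HG.
  rewrite EY in HY; apply: (PImpL HY); last by apply: IHB; auto; apply: ext.
  apply: (PEq e HA (B := A')); first by left.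
  by apply: prov_incl (IHA P e HP) _ _; auto 10 with incl.
- move=> G D A B HD _ IH P e HP; apply: (PImpR HD).
  by apply: IH; auto; apply: ext => //; exact: repl_refl.
- move=> G D A t HG _ IH P e HP; have [Y [HY /= [A' [EY HA]]]] := HP _ HG.
  rewrite EY in HY; apply: (PAllL (t := t) HY); apply: IH; auto.
  by apply: ext => //; exact: repl_inst.
- by move=> G D A HD _ IH P e HP; apply: (PAllR HD) => t; apply: IH; auto.
- move=> G D A HG _ IH P e HP; have [Y [HY /= [A' [EY HA]]]] := HP _ HG.
  rewrite EY in HY; apply: (PExL HY) => t; apply: (IH t); auto.
  by apply: ext => //; exact: repl_inst.
- by move=> G D A t HD _ IH P e HP; apply: (PExR (t := t) HD); auto.
- by move=> G D t HD P e HP; exact: PRefl HD.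
- move=> G D p q A B Hpq HAB HB _ IH P e HP.
  have [p' [q' [Hp Hq e']]] : exists p' q',
      [/\ trepl r s p p', trepl r s q q' & has_eq P p' q'].
    case: Hpq => /HP[Y [HY /= [a [b [EY Ha Hb]]]]]; rewrite EY in HY.
      by exists a, b; split=> //; left.
    by exists b, a; split=> //; right.
  (* A, A', B', B are derived in this order *)
  have [A' [B' [HA HAB' HBB']]] := repl_square Hp Hq HAB.
  have e2 : has_eq P s r by case: e; [right|left].
  apply: (PEq e2 (repl_sym HBB') HB).
  apply: (PEq e' HAB' (B := B')); first by left.
  apply: (PEq e HA (B := A')); first by left.
  by apply: prov_incl (IH P e HP) _ _; auto 10 with incl.
Qed.

(** * Cut elimination *)

(** The premises of the right rule that introduces [F], except that for an
    equation it is the condition for a reflexivity axiom; nothing introduces a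
    predicate formula. *)
Definition intro_premises {L : signature} lj (F : formula L)
    (P S : seq (formula L)) : Prop :=
  match F with
  | Pred _ _ => False
  | Eq r s => r = s
  | Not A => prov lj (A :: P) (side lj S)
  | And A B => prov lj P (A :: side lj S) /\ prov lj P (B :: side lj S)
  | Or A B => prov lj P (A :: side lj S) \/ prov lj P (B :: side lj S)
  | Imp A B => prov lj (A :: P) (B :: side lj S)
  | All A => forall t, prov lj P (inst t A :: side lj S)
  | Ex A => exists t, prov lj P (inst t A :: side lj S)
  end.

Lemma intro_premises_incl (L : signature) lj (F : formula L) P S P' S' :
  intro_premises lj F P S -> List.incl P P' ->
  List.incl (side lj S) (side lj S') -> intro_premises lj F P' S'.
Proof.
case: F => //=.
- by move=> A H HP HS; apply: prov_incl H _ _; auto 10 with incl.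
- move=> A B [HA HB] HP HS; split.
    by apply: prov_incl HA _ _; auto 10 with incl.
  by apply: prov_incl HB _ _; auto 10 with incl.
- by move=> A B [H|H] HP HS; [left|right]; apply: prov_incl H _ _;
    auto 10 with incl.
- by move=> A B H HP HS; apply: prov_incl H _ _; auto 10 with incl.
- by move=> A H HP HS t; apply: prov_incl (H t) _ _; auto 10 with incl.
- by move=> A [t H] HP HS; exists t; apply: prov_incl H _ _; auto 10 with incl.
Qed.

Lemma prov_intro (L : signature) lj (F : formula L) P S :
  List.In F S -> intro_premises lj F P S -> prov lj P S.
Proof.
case: F => //=.
- by move=> r s + E; rewrite -E; exact: PRefl.
- by move=> A; exact: PNotR.
- by move=> A B H [HA HB]; exact: PAndR H HA HB.
- by move=> A B H [HA|HB]; [exact: POrR1 H HA|exact: POrR2 H HB].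
- by move=> A B; exact: PImpR.
- by move=> A; exact: PAllR.
- by move=> A H [t Ht]; exact: PExR H Ht.
Qed.

(** Both premises share their contexts, which costs nothing for sets. *)
Definition cut_below (L : signature) lj k : Prop :=
  forall (P S : seq (formula L)) X, csize X < k ->
    prov lj P (X :: S) -> prov lj (X :: P) S -> prov lj P S.

(** The cut formula has just been introduced on the left of the cut: induction
    on the right proof until it is introduced there as well.  [F] may persist
    above a left rule for [F]; the induction hypothesis removes that copy, and
    cuts on the immediate subformulae of [F] remain. *)
Lemma cut_principal (L : signature) lj (F : formula L) G D P S :
  cut_below L lj (csize F) -> prov lj G D ->
  List.incl G (F :: P) -> List.incl D S ->
  intro_premises lj F P S -> prov lj P S.
Proof.
move=> cut H; elim: H P S => {G D}.
- move=> G D X HG HD P S HP HS HF.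
  case: (HP _ HG) => [E|HX]; last by apply: PAx HX _; exact: HS.
  by apply: prov_intro HF; rewrite E; exact: HS.
- move=> G D A HG _ IH P S HP HS HF.
  have HA : prov lj P (A :: side lj S).
    apply: IH; auto 10 with incl.
    by apply: intro_premises_incl HF _ _; auto 10 with incl.
  case: (HP _ HG) => [E|HX]; last exact: PNotL HX HA.
  rewrite E /= in HF cut.
  apply: (@prov_incl _ _ P (side lj S)); auto 10 with incl.
  by apply: cut HA HF.
- move=> G D A HD _ IH P S HP HS HF.
  apply: (PNotR (HS _ HD)); apply: IH; auto 10 with incl.
  by apply: intro_premises_incl HF _ _; auto 10 with incl.
- move=> G D A B HG _ IH P S HP HS HF.
  have HA : prov lj (A :: P) S.
    apply: IH; auto 10 with incl.
    by apply: intro_premises_incl HF _ _; auto 10 with incl.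
  case: (HP _ HG) => [E|HX]; last exact: PAndL1 HX HA.
  rewrite E /= in HF cut; case: HF => HF _.
  apply: (cut P S A) HA; first by rewrite ltnS leq_addr.
  by apply: prov_incl HF _ _; auto 10 with incl.
- move=> G D A B HG _ IH P S HP HS HF.
  have HB : prov lj (B :: P) S.
    apply: IH; auto 10 with incl.
    by apply: intro_premises_incl HF _ _; auto 10 with incl.
  case: (HP _ HG) => [E|HX]; last exact: PAndL2 HX HB.
  rewrite E /= in HF cut; case: HF => _ HF.
  apply: (cut P S B) HB; first by rewrite ltnS leq_addl.
  by apply: prov_incl HF _ _; auto 10 with incl.
- move=> G D A B HD _ IHA _ IHB P S HP HS HF.
  by apply: (PAndR (HS _ HD)); [apply: IHA|apply: IHB]; auto 10 with incl;
    apply: intro_premises_incl HF _ _; auto 10 with incl.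
- move=> G D A B HG _ IHA _ IHB P S HP HS HF.
  have HA : prov lj (A :: P) S.
    apply: IHA; auto 10 with incl.
    by apply: intro_premises_incl HF _ _; auto 10 with incl.
  have HB : prov lj (B :: P) S.
    apply: IHB; auto 10 with incl.
    by apply: intro_premises_incl HF _ _; auto 10 with incl.
  case: (HP _ HG) => [E|HX]; last exact: POrL HX HA HB.
  rewrite E /= in HF cut; case: HF => HF.
  + apply: (cut P S A) HA; first by rewrite ltnS leq_addr.
    by apply: prov_incl HF _ _; auto 10 with incl.
  + apply: (cut P S B) HB; first by rewrite ltnS leq_addl.
    by apply: prov_incl HF _ _; auto 10 with incl.
- move=> G D A B HD _ IH P S HP HS HF.
  apply: (POrR1 (HS _ HD)); apply: IH; auto 10 with incl.
  by apply: intro_premises_incl HF _ _; auto 10 with incl.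
- move=> G D A B HD _ IH P S HP HS HF.
  apply: (POrR2 (HS _ HD)); apply: IH; auto 10 with incl.
  by apply: intro_premises_incl HF _ _; auto 10 with incl.
- move=> G D A B HG _ IHA _ IHB P S HP HS HF.
  have HA : prov lj P (A :: side lj S).
    apply: IHA; auto 10 with incl.
    by apply: intro_premises_incl HF _ _; auto 10 with incl.
  have HB : prov lj (B :: P) S.
    apply: IHB; auto 10 with incl.
    by apply: intro_premises_incl HF _ _; auto 10 with incl.
  case: (HP _ HG) => [E|HX]; last exact: PImpL HX HA HB.
  rewrite E /= in HF cut.
  apply: (cut P S B) HB; first by rewrite ltnS leq_addl.
  apply: (@prov_incl _ _ P (B :: side lj S)); auto 10 with incl.
  apply: (cut _ _ A) HF; first by rewrite ltnS leq_addr.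
  by apply: prov_incl HA _ _; auto 10 with incl.
- move=> G D A B HD _ IH P S HP HS HF.
  apply: (PImpR (HS _ HD)); apply: IH; auto 10 with incl.
  by apply: intro_premises_incl HF _ _; auto 10 with incl.
- move=> G D A t HG _ IH P S HP HS HF.
  have HA : prov lj (inst t A :: P) S.
    apply: IH; auto 10 with incl.
    by apply: intro_premises_incl HF _ _; auto 10 with incl.
  case: (HP _ HG) => [E|HX]; last exact: PAllL HX HA.
  rewrite E /= in HF cut.
  apply: (cut P S (inst t A)) HA; first by rewrite csize_inst.
  by apply: prov_incl (HF t) _ _; auto 10 with incl.
- move=> G D A HD _ IH P S HP HS HF.
  apply: (PAllR (HS _ HD)) => t; apply: IH; auto 10 with incl.
  by apply: intro_premises_incl HF _ _; auto 10 with incl.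
- move=> G D A HG _ IH P S HP HS HF.
  have HA t : prov lj (inst t A :: P) S.
    apply: IH; auto 10 with incl.
    by apply: intro_premises_incl HF _ _; auto 10 with incl.
  case: (HP _ HG) => [E|HX]; last exact: PExL HX HA.
  rewrite E /= in HF cut; case: HF => t HF.
  apply: (cut P S (inst t A)) (HA t); first by rewrite csize_inst.
  by apply: prov_incl HF _ _; auto 10 with incl.
- move=> G D A t HD _ IH P S HP HS HF.
  apply: (PExR (t := t) (HS _ HD)); apply: IH; auto 10 with incl.
  by apply: intro_premises_incl HF _ _; auto 10 with incl.
- by move=> G D t HD P S HP HS _; apply: PRefl (HS _ HD).
- move=> G D r s A B Hrs HAB HB _ IH P S HP HS HF.
  have HA : prov lj P (A :: side lj S).
    apply: IH; auto 10 with incl.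
    by apply: intro_premises_incl HF _ _; auto 10 with incl.
  have [HX|E] : has_eq P r s \/ r = s.
    case: Hrs => /HP[E|H]; [|by left; left| |by left; right].
      by right; rewrite E in HF.
    by right; rewrite E in HF.
  + exact: PEq HX HAB (HS _ HB) HA.
  + rewrite E in HAB; rewrite (repl_id HAB) in HA.
    apply: prov_incl HA (List.incl_refl _) _.
    by apply: incl_consl; auto 10 with incl; exact: HS.
Qed.

(** The succedent of a left proof, split into formulae to be kept and formulae
    to be cut, each of the latter with the other premise of its cut.  Above an
    equality rule that produces a cut formula [B] from [A], both [A] and further
    copies of [B] may have to be cut, hence a set of cut formulae. *)
Definition cuttable {L : signature} lj k (P S D : seq (formula L)) : Prop :=
  forall X, List.In X D ->
    List.In X S \/ csize X <= k /\ prov lj (X :: P) S.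

Lemma cuttable_cons (L : signature) lj k (A : formula L) P S D :
  cuttable lj k P S D -> cuttable lj k (A :: P) S D.
Proof.
move=> H Y /H[|[HY HYP]]; [by left|right; split=> //].
by apply: prov_incl HYP _ _; auto 10 with incl.
Qed.

Lemma cuttable_premise (L : signature) lj k (P S D Q E : seq (formula L)) :
  cuttable lj k P S D -> List.incl P Q ->
  cuttable lj k Q (E ++ side lj S) (E ++ side lj D).
Proof.
move=> H HQ X /List.in_app_iff[HX|HX].
  by left; apply/List.in_app_iff; left.
case: lj H HX => //= H /H[HX|[HX HXP]]; [left|right].
  by apply/List.in_app_iff; right.
split=> //; apply: prov_incl HXP _ _; first exact: incl_cons2.
exact: List.incl_appr (List.incl_refl _).
Qed.

(** A right rule has introduced [F]: either [F] is kept and the rule is applied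
    again, or [F] is to be cut and is principal. *)
Lemma cuttable_prov (L : signature) lj k (F : formula L) P S D :
  cut_below L lj k -> cuttable lj k P S D -> List.In F D ->
  intro_premises lj F P S -> prov lj P S.
Proof.
move=> cut H /H[HF|[Hk HF]]; first exact: prov_intro HF.
apply: cut_principal HF _ _; auto 10 with incl => Q T X HX.
by apply: cut; apply: leq_trans HX Hk.
Qed.

(** Induction on the left proof.  The only new cut formulae on the way up are
    premises of equality rules, which have as many connectives as their
    conclusions. *)
Lemma cut_set (L : signature) lj k (G D P S : seq (formula L)) :
  cut_below L lj k -> prov lj G D -> List.incl G P ->
  cuttable lj k P S D -> prov lj P S.
Proof.
move=> cut H; elim: H P S => {G D}.
- move=> G D X HG HD P S HP HS.
  case: (HS _ HD) => [HX|[_ HX]]; first exact: PAx (HP _ HG) HX.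
  apply: prov_incl HX _ (List.incl_refl _).
  exact: incl_consl (HP _ HG) (List.incl_refl _).
- move=> G D A HG _ IH P S HP HS; apply: (PNotL (HP _ HG)); apply: IH => //.
  exact: (cuttable_premise (E := [:: A])) HS
    (@List.incl_refl _ _).
- move=> G D A HD _ IH P S HP HS; apply: (cuttable_prov cut HS HD) => /=.
  apply: IH; auto 10 with incl.
  by apply: (cuttable_premise (E := [::])) HS _; auto 10 with incl.
- move=> G D A B HG _ IH P S HP HS; apply: (PAndL1 (HP _ HG)).
  by apply: IH; auto 10 with incl; exact: cuttable_cons.
- move=> G D A B HG _ IH P S HP HS; apply: (PAndL2 (HP _ HG)).
  by apply: IH; auto 10 with incl; exact: cuttable_cons.
- move=> G D A B HD _ IHA _ IHB P S HP HS; apply: (cuttable_prov cut HS HD).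
  split; [apply: IHA|apply: IHB]; auto 10 with incl.
    exact: (cuttable_premise (E := [:: A])) HS
    (@List.incl_refl _ _).
  exact: (cuttable_premise (E := [:: B])) HS
    (@List.incl_refl _ _).
- move=> G D A B HG _ IHA _ IHB P S HP HS; apply: (POrL (HP _ HG)).
    by apply: IHA; auto 10 with incl; exact: cuttable_cons.
  by apply: IHB; auto 10 with incl; exact: cuttable_cons.
- move=> G D A B HD _ IH P S HP HS; apply: (cuttable_prov cut HS HD); left.
  by apply: IH => //; exact: (cuttable_premise (E := [:: A])) HS
    (@List.incl_refl _ _).
- move=> G D A B HD _ IH P S HP HS; apply: (cuttable_prov cut HS HD); right.
  by apply: IH => //; exact: (cuttable_premise (E := [:: B])) HS
    (@List.incl_refl _ _).
- move=> G D A B HG _ IHA _ IHB P S HP HS; apply: (PImpL (HP _ HG)).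
    by apply: IHA => //; exact: (cuttable_premise (E := [:: A])) HS
    (@List.incl_refl _ _).
  by apply: IHB; auto 10 with incl; exact: cuttable_cons.
- move=> G D A B HD _ IH P S HP HS; apply: (cuttable_prov cut HS HD) => /=.
  apply: IH; auto 10 with incl.
  by apply: (cuttable_premise (E := [:: B])) HS _; auto 10 with incl.
- move=> G D A t HG _ IH P S HP HS; apply: (PAllL (t := t) (HP _ HG)).
  by apply: IH; auto 10 with incl; exact: cuttable_cons.
- move=> G D A HD _ IH P S HP HS; apply: (cuttable_prov cut HS HD) => t.
  by apply: IH => //; exact: (cuttable_premise (E := [:: _])) HS
    (@List.incl_refl _ _).
- move=> G D A HG _ IH P S HP HS; apply: (PExL (HP _ HG)) => t.
  by apply: (IH t); auto 10 with incl; exact: cuttable_cons.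
- move=> G D A t HD _ IH P S HP HS; apply: (cuttable_prov cut HS HD).
  by exists t; apply: IH => //; exact: (cuttable_premise (E := [:: _])) HS
    (@List.incl_refl _ _).
- by move=> G D t HD P S HP HS; exact: (cuttable_prov cut HS HD).
- move=> G D r s A B Hrs HAB HB _ IH P S HP HS.
  have Hrs' := has_eq_incl HP Hrs.
  case: (HS _ HB) => [HX|[Hk HX]].
    apply: (PEq Hrs' HAB HX); apply: IH => //.
    exact: (cuttable_premise (E := [:: A])) HS
    (@List.incl_refl _ _).
  (* B is cut: instead of applying the rule, cut its premise A against the
     right proof of B with B rewritten to A *)
  apply: IH => // Y /= [<-|/(incl_sidel (List.incl_refl D)) /HS//]; right.
  split; first by rewrite -(csize_repl HAB).
  have e2 : has_eq (A :: P) s r.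
    by case: Hrs' => ?; [right|left]; right.
  apply: (prov_repl HX e2) => Z /= [<-|HZ].
    by exists A; split; [left|exact: repl_sym].
  by exists Z; split; [right|exact: repl_refl].
Qed.

Lemma cut_below_all (L : signature) lj k : cut_below L lj k.
Proof.
elim: k => // k IH P S X HX H1 H2.
apply: (cut_set IH H1); auto 10 with incl => Y /= [<-|]; last by left.
by right.
Qed.

Lemma prov_cut (L : signature) lj (P S : seq (formula L)) X :
  prov lj P (X :: S) -> prov lj (X :: P) S -> prov lj P S.
Proof. exact: (@cut_below_all L lj (csize X).+1). Qed.

(** * Embedding the sequent calculi *)

Lemma in_rcons_iff T (x y : T) l :
  List.In y (rcons l x) <-> x = y \/ List.In y l.
Proof. by elim: l => [|z l IH] /=; rewrite ?IH; tauto. Qed.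

Lemma in_cat_iff T (y : T) l1 l2 :
  List.In y (l1 ++ l2) <-> List.In y l1 \/ List.In y l2.
Proof. exact: List.in_app_iff. Qed.

Ltac mem := rewrite ?map_rcons ?map_cat /=
  ?(in_rcons_iff, in_cat_iff) /= ?(in_rcons_iff, in_cat_iff) /=; tauto.
Ltac inc := intro; mem.

Definition bounded {T : Type} (lj : bool) (D : seq T) : Prop :=
  lj -> size D <= 1.

(** In the intuitionistic case an active succedent formula is alone in its
    succedent. *)
Lemma side_rcons T U (f : T -> U) lj (D : seq T) A (E : seq U) :
  bounded lj (rcons D A) -> List.incl (map f D) E ->
  List.incl (map f D) (side lj E).
Proof.
case: lj => // /(_ isT); rewrite size_rcons ltnS leqn0.
by case: D => //= _ _ x [].
Qed.

Lemma side_premise T U (f : T -> U) lj (D : seq T) A (E : seq U) :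
  bounded lj (rcons D A) -> List.incl (map f D) E ->
  List.incl (map f (rcons D A)) (f A :: side lj E).
Proof.
move=> b H X; rewrite map_rcons in_rcons_iff => -[|HX]; [by left|right].
exact: side_rcons b H _ HX.
Qed.

Lemma map_fsub_ext (L : signature) (l : seq (formula L)) sg tau :
  (forall F v, List.In F l -> occurs v F -> sg v = tau v) ->
  map (fsub sg) l = map (fsub tau) l.
Proof.
elim: l => //= F l IH H; rewrite IH; last by move=> G v HG; apply: H; right.
by congr cons; apply: fsub_ext => v; apply: H; left.
Qed.

(** Redirecting a substitution at an eigenvariable reaches every instance, and
    changes nothing else; this is how one premise of an eigenvariable rule
    yields a premise for every term. *)
Lemma fsub_eigen (L : signature) a t sg (A : semiformula L 1)
    (tau := fun v => if v == a then t else sg v) :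
  ~ occurs a A -> fsub tau (inst (FVar a) A) = inst t (fsub sg A).
Proof.
move=> Ha; rewrite fsub_inst /= /tau eqxx lift_term0; congr inst.
by apply: fsub_ext => v Hv; case: eqP Hv => [->|].
Qed.

Lemma map_fsub_eigen (L : signature) a t sg (l : seq (formula L))
    (tau := fun v => if v == a then t else sg v) :
  (forall F, List.In F l -> ~ occurs a F) ->
  map (fsub tau) l = map (fsub sg) l.
Proof.
by move=> H; apply: map_fsub_ext => F v /H HF; rewrite /tau; case: eqP => [->|].
Qed.

(** Quantified over substitutions, so that the induction hypothesis can be used
    at several substitutions of an eigenvariable. *)
Lemma prov_of_derivable (L : signature) lj (R : rule L) :
  (forall Ps S, R Ps S ->
     LKeq Ps S /\ forall T, List.In T (S :: Ps) -> bounded lj (succ T)) ->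
  forall S, derivable R S ->
  forall sg, prov lj (map (fsub sg) (ante S)) (map (fsub sg) (succ S)).
Proof.
move=> HR S; elim=> {S} Ps S /HR[HS HB] _.
have {HB} [bS] : bounded lj (succ S) /\
    forall P, List.In P Ps -> bounded lj (succ P).
  by split=> [|P HP]; apply: HB; [left|right].
move: HS bS => [[]|] [] /=.
- move=> G D F _ _ IH sg; have := IH _ (or_introl erefl) sg.
  by move/prov_incl; apply; inc.
- move=> G D F _ _ IH sg; have := IH _ (or_introl erefl) sg.
  by move/prov_incl; apply; inc.
- move=> G1 G2 D E F _ _ IH sg; have := IH _ (or_introl erefl) sg.
  by move/prov_incl; apply; inc.
- move=> G D1 D2 E F _ _ IH sg; have := IH _ (or_introl erefl) sg.
  by move/prov_incl; apply; inc.
- move=> G D F _ _ IH sg; have := IH _ (or_introl erefl) sg.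
  by move/prov_incl; apply; inc.
- move=> G D F _ _ IH sg; have := IH _ (or_introl erefl) sg.
  by move/prov_incl; apply; inc.
- by move=> F _ _ _ sg; apply: (@PAx _ _ _ _ (fsub sg F)) => /=; left.
- move=> G D A _ /(_ _ (or_introl erefl)) b /(_ _ (or_introl erefl)) IH sg.
  apply: (@PNotL _ _ _ _ (fsub sg A)); first by mem.
  by apply: prov_incl (IH sg) _ _; [inc|apply: side_premise].
- move=> G D A b _ /(_ _ (or_introl erefl)) IH sg.
  apply: (@PNotR _ _ _ _ (fsub sg A)); first by mem.
  by apply: prov_incl (IH sg) _ _; [inc|apply: side_rcons b _; inc].
- move=> G D A B _ _ /(_ _ (or_introl erefl)) IH sg.
  apply: (@PAndL1 _ _ _ _ (fsub sg A) (fsub sg B)); first by mem.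
  by apply: prov_incl (IH sg) _ _; inc.
- move=> G D A B _ _ /(_ _ (or_introl erefl)) IH sg.
  apply: (@PAndL2 _ _ _ _ (fsub sg A) (fsub sg B)); first by mem.
  by apply: prov_incl (IH sg) _ _; inc.
- move=> G D A B _ b IH sg.
  have b1 := b _ (or_introl erefl).
  have b2 := b _ (or_intror (or_introl erefl)).
  apply: (@PAndR _ _ _ _ (fsub sg A) (fsub sg B)); first by mem.
  + apply: prov_incl (IH _ (or_introl erefl) sg) _ _; first by inc.
    by apply: side_premise b1 _; inc.
  + apply: prov_incl (IH _ (or_intror (or_introl erefl)) sg) _ _; first by inc.
    by apply: side_premise b2 _; inc.
- move=> G D A B _ _ IH sg.
  apply: (@POrL _ _ _ _ (fsub sg A) (fsub sg B)); first by mem.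
  + by apply: prov_incl (IH _ (or_introl erefl) sg) _ _; inc.
  + by apply: prov_incl (IH _ (or_intror (or_introl erefl)) sg) _ _; inc.
- move=> G D A B _ /(_ _ (or_introl erefl)) b /(_ _ (or_introl erefl)) IH sg.
  apply: (@POrR1 _ _ _ _ (fsub sg A) (fsub sg B)); first by mem.
  by apply: prov_incl (IH sg) _ _; [inc|apply: side_premise b _; inc].
- move=> G D A B _ /(_ _ (or_introl erefl)) b /(_ _ (or_introl erefl)) IH sg.
  apply: (@POrR2 _ _ _ _ (fsub sg A) (fsub sg B)); first by mem.
  by apply: prov_incl (IH sg) _ _; [inc|apply: side_premise b _; inc].
- move=> G1 G2 D1 D2 A B _ /(_ _ (or_introl erefl)) b IH sg.
  apply: (@PImpL _ _ _ _ (fsub sg A) (fsub sg B)); first by mem.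
  + apply: prov_incl (IH _ (or_introl erefl) sg) _ _; first by inc.
    by apply: side_premise b _; inc.
  + by apply: prov_incl (IH _ (or_intror (or_introl erefl)) sg) _ _; inc.
- move=> G D A B _ /(_ _ (or_introl erefl)) b /(_ _ (or_introl erefl)) IH sg.
  apply: (@PImpR _ _ _ _ (fsub sg A) (fsub sg B)); first by mem.
  by apply: prov_incl (IH sg) _ _; [inc|apply: side_premise b _; inc].
- move=> G D A t _ _ /(_ _ (or_introl erefl)) IH sg.
  apply: (@PAllL _ _ _ _ (fsub sg A) (tsub sg t)); first by mem.
  by rewrite -fsub_inst; apply: prov_incl (IH sg) _ _; inc.
- move=> G D A a Ha _ /(_ _ (or_introl erefl)) b /(_ _ (or_introl erefl)) IH sg.
  have Hin F : List.In F (G ++ rcons D (All A)) -> ~ occurs a F.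
    by move=> HF Ho; apply: Ha; exists F.
  apply: (@PAllR _ _ _ _ (fsub sg A)); first by mem.
  move=> t; have := IH (fun v => if v == a then t else sg v); rewrite /= => H.
  apply: prov_incl H _ _.
    rewrite map_fsub_eigen // => F HF; apply: Hin; by mem.
  rewrite -(@fsub_eigen _ a) //; last by apply: (Hin (All A)); mem.
  apply: side_premise b _.
  rewrite map_fsub_eigen; first by inc.
  by move=> F HF; apply: Hin; mem.
- move=> G D A a Ha _ _ /(_ _ (or_introl erefl)) IH sg.
  have Hin F : List.In F (rcons G (Ex A) ++ D) -> ~ occurs a F.
    by move=> HF Ho; apply: Ha; exists F.
  apply: (@PExL _ _ _ _ (fsub sg A)); first by mem.
  move=> t; have := IH (fun v => if v == a then t else sg v); rewrite /= => H.
  apply: prov_incl H _ _.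
    rewrite map_rcons fsub_eigen; last by apply: (Hin (Ex A)); mem.
    rewrite map_fsub_eigen; first by inc.
    by move=> F HF; apply: Hin; mem.
  by rewrite map_fsub_eigen // => F HF; apply: Hin; mem.
- move=> G D A t _ /(_ _ (or_introl erefl)) b /(_ _ (or_introl erefl)) IH sg.
  apply: (@PExR _ _ _ _ (fsub sg A) (tsub sg t)); first by mem.
  rewrite -fsub_inst.
  by apply: prov_incl (IH sg) _ _; [inc|apply: side_premise b _; inc].
- by move=> t _ _ _ sg; apply: (@PRefl _ _ _ _ (tsub sg t)); left.
- move=> G D F v r s _ _ _ /(_ _ (or_introl erefl)) b.
  move=> /(_ _ (or_introl erefl)) IH sg.
  apply: (PEq _ (repl_subst v r s F sg)); [by left; mem|by mem|].
  by apply: prov_incl (IH sg) _ _; [inc|apply: side_premise b _; inc].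
- move=> G D F v r s _ _ _ /(_ _ (or_introl erefl)) b.
  move=> /(_ _ (or_introl erefl)) IH sg.
  apply: (PEq _ (repl_subst v r s F sg)); [by right; mem|by mem|].
  by apply: prov_incl (IH sg) _ _; [inc|apply: side_premise b _; inc].
- move=> G1 G2 D1 D2 F _ b IH sg.
  apply: (@prov_cut _ _ _ _ (fsub sg F)).
  + by apply: prov_incl (IH _ (or_introl erefl) sg) _ _; inc.
  + by apply: prov_incl (IH _ (or_intror (or_introl erefl)) sg) _ _; inc.
Qed.

(** * Reading infinitary proofs back *)

(** The structural rules make a context a set.  To pass from [l] to [l'], weaken
    [l] to [l ++ l'] and contract the formulae of [l] away. *)
Lemma incl_closed T (P : seq T -> Prop) :
  (forall l x, P l -> P (rcons l x)) ->
  (forall l1 l2 x y, P (l1 ++ x :: y :: l2) -> P (l1 ++ y :: x :: l2)) ->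
  (forall l x, P (rcons (rcons l x) x) -> P (rcons l x)) ->
  forall l l', List.incl l l' -> P l -> P l'.
Proof.
move=> weak exch contr.
have perm (l l' : seq T) : Permutation.Permutation l l' ->
    forall p, P (p ++ l) -> P (p ++ l').
  elim=> {l l'} [//|x l l' _ IH p|x y l p|l1 l2 l3 _ IH1 _ IH2 p].
  - by rewrite -!cat_rcons; exact: IH.
  - exact: exch.
  - by move/IH1/IH2.
have perm_cons (l : seq T) x : Permutation.Permutation (rcons l x) (x :: l).
  rewrite -cats1; apply: Permutation.Permutation_sym.
  exact: Permutation.Permutation_cons_append.
have absorb (l : seq T) x : List.In x l -> P (x :: l) -> P l.
  move=> Hx; have [l1 [l2 ->]] := List.in_split _ _ Hx => H.
  have e : Permutation.Permutation (l1 ++ x :: l2) (x :: (l1 ++ l2)).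
    exact/Permutation.Permutation_sym/Permutation.Permutation_middle.
  apply: (perm _ _ (Permutation.Permutation_sym e) [::]).
  apply: (perm _ _ (perm_cons _ _) [::]); apply: contr.
  apply: (perm (x :: (l1 ++ x :: l2)) _ _ [::]) H.
  apply: Permutation.Permutation_trans
    (Permutation.Permutation_sym (perm_cons _ _)).
  apply: Permutation.perm_skip; apply: Permutation.Permutation_trans e _.
  exact: Permutation.Permutation_sym.
have absorbs (l l' : seq T) : List.incl l l' -> P (l ++ l') -> P l'.
  elim: l => //= x l IH H HP; apply: IH => [y Hy|]; first by apply: H; right.
  by apply: absorb HP; apply/List.in_app_iff; right; apply: H; left.
have weaks l l' : P l -> P (l ++ l').
  elim: l' l => [|x l' IH] l; first by rewrite cats0.
  by move=> H; rewrite -cat_rcons; apply/IH/weak.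
move=> l l' H HP; exact: absorbs H (weaks _ _ HP).
Qed.

Definition contains_bounded_cutfree {L : signature} lj (R : rule L) : Prop :=
  forall Ps S, cutfree_LKeq Ps S ->
    (forall T, List.In T (S :: Ps) -> bounded lj (succ T)) -> R Ps S.

Lemma derive0 (L : signature) lj (R : rule L) S :
  contains_bounded_cutfree lj R -> cutfree_LKeq [::] S -> bounded lj (succ S) ->
  derivable R S.
Proof.
by move=> HR HS b; apply: (@Derive _ _ [::]) => //; apply: HR => // T [<-|].
Qed.

Lemma derive1 (L : signature) lj (R : rule L) P S :
  contains_bounded_cutfree lj R -> cutfree_LKeq [:: P] S ->
  bounded lj (succ P) ->
  bounded lj (succ S) -> derivable R P -> derivable R S.
Proof.
move=> HR HS bP bS HP; apply: (@Derive _ _ [:: P]); last by move=> Q [<-|].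
by apply: HR => // T [<-|[<-|]].
Qed.

Lemma derive2 (L : signature) lj (R : rule L) P Q S :
  contains_bounded_cutfree lj R -> cutfree_LKeq [:: P; Q] S ->
  bounded lj (succ P) ->
  bounded lj (succ Q) -> bounded lj (succ S) ->
  derivable R P -> derivable R Q -> derivable R S.
Proof.
move=> HR HS bP bQ bS HP HQ; apply: (@Derive _ _ [:: P; Q]).
  by apply: HR => // T [<-|[<-|[<-|]]].
by move=> T [<-|[<-|]].
Qed.

(** An intuitionistic succedent has no room for a contraction or an exchange:
    the only possible change is one weakening of an empty succedent. *)
Lemma derivable_incl (L : signature) lj (R : rule L) G D G' D' :
  contains_bounded_cutfree lj R -> bounded lj D -> bounded lj D' ->
  List.incl G G' -> List.incl D D' ->
  derivable R (G ==>> D) -> derivable R (G' ==>> D').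
Proof.
move=> HR bD bD' HG HD H.
have {H} : derivable R (G' ==>> D).
  apply: (incl_closed (P := fun l => derivable R (l ==>> D))) HG H.
  - by move=> l x; apply: derive1 HR _ _ _ => //; apply: Or31; constructor.
  - move=> l1 l2 x y; apply: derive1 HR _ _ _ => //.
    by apply: Or31; constructor.
  - by move=> l x; apply: derive1 HR _ _ _ => //; apply: Or31; constructor.
case: lj HR bD bD' => HR bD bD'.
  move: {bD} (bD isT) {bD'} (bD' isT).
  case: D D' HD => [|A [|//]] [|B [|//]] //= HD _ _.
  - apply: (derive1 HR) => //; apply: Or31; exact: (WeakenR G' [::] B).
  - by case: (HD A); left.
  - by case: (HD A) => [|->|] //; left.
apply: (incl_closed (P := fun l => derivable R (G' ==>> l))) HD.
- by move=> l x; apply: derive1 HR _ _ _ => //; apply: Or31; constructor.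
- by move=> l1 l2 x y; apply: derive1 HR _ _ _ => //; apply: Or31; constructor.
- by move=> l x; apply: derive1 HR _ _ _ => //; apply: Or31; constructor.
Qed.

Lemma fresh_variable (L : signature) (l : seq (formula L)) (ts : seq (term L)) :
  exists a, (forall F, List.In F l -> ~ occurs a F) /\
            (forall t, List.In t ts -> ~ term_occurs a t).
Proof.
have [N HN] := list_bound (l ++ [seq Eq t t | t <- ts]).
exists N; split=> [F HF Ho|t Ht Ho]; suff: N < N by rewrite ltnn.
  by apply: (HN F) Ho; apply/in_cat_iff; left.
apply: (HN (Eq t t)); last by left.
by apply/in_cat_iff; right; exact: (List.in_map (fun t => Eq t t)).
Qed.

Lemma bounded_side T lj (A : T) (D : seq T) : bounded lj (A :: side lj D).
Proof. by case: lj. Qed.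

Lemma bounded_rcons_side T lj (A : T) (D : seq T) :
  bounded lj (rcons (side lj D) A).
Proof. by case: lj. Qed.

Lemma bounded_side_self T lj (D : seq T) : bounded lj (side lj D).
Proof. by case: lj. Qed.

(** The rules of [prov] keep their principal formula; here it is contracted. *)
Lemma derivable_absorbR (L : signature) lj (R : rule L) G D X :
  contains_bounded_cutfree lj R -> List.In X D -> bounded lj D ->
  derivable R (G ==>> rcons (side lj D) X) -> derivable R (G ==>> D).
Proof.
move=> HR HX b; apply: (derivable_incl HR) => //.
  exact: bounded_rcons_side.
move=> Y /in_rcons_iff[<-//|]; exact: (incl_sidel (List.incl_refl D)).
Qed.

Lemma derivable_absorbL (L : signature) lj (R : rule L) G D X :
  contains_bounded_cutfree lj R -> List.In X G -> bounded lj D ->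
  derivable R (rcons G X ==>> D) -> derivable R (G ==>> D).
Proof.
move=> HR HX b; apply: (derivable_incl HR) => //.
by move=> Y /in_rcons_iff[<-|].
Qed.

Lemma derivable_rconsR (L : signature) lj (R : rule L) G D A :
  contains_bounded_cutfree lj R -> derivable R (G ==>> A :: side lj D) ->
  derivable R (G ==>> rcons (side lj D) A).
Proof.
move=> HR; apply: (derivable_incl HR) => //; first exact: bounded_side.
  exact: bounded_rcons_side.
by move=> X /= HX; rewrite in_rcons_iff.
Qed.

Lemma derivable_rconsL (L : signature) lj (R : rule L) G D A :
  contains_bounded_cutfree lj R -> bounded lj D ->
  derivable R (A :: G ==>> D) ->
  derivable R (rcons G A ==>> D).
Proof.
move=> HR b; apply: (derivable_incl HR) => //.
by move=> X /= HX; rewrite in_rcons_iff.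
Qed.

(** Only rules without cut are used to read a proof back, and each keeps the
    succedents within the bound.  Of the premises indexed by all terms, the one
    for a fresh variable is enough. *)
Lemma derivable_of_prov (L : signature) lj (R : rule L) G D :
  contains_bounded_cutfree lj R -> prov lj G D -> bounded lj D ->
  derivable R (G ==>> D).
Proof.
move=> HR.
have bs := @bounded_side (formula L) lj.
have br := @bounded_rcons_side (formula L) lj.
have bss := @bounded_side_self (formula L) lj.
have rR := derivable_rconsR HR.
have rL G' D' A := @derivable_rconsL L lj R G' D' A HR.
elim=> {G D}.
- move=> G D F HG HD b.
  apply: (derivable_incl (G := [:: F]) (D := [:: F]) HR) => //.
  + by move=> X /= [<-|].
  + by move=> X /= [<-|].
  + by apply: (derive0 HR) => //; apply: Or32; constructor.
- move=> G D A HX _ /(_ (bs _ _)) IH b.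
  apply: (derivable_absorbL HR HX b).
  apply: (derivable_incl (G := rcons G (Not A)) (D := side lj D) HR) => //.
    exact: incl_sidel (List.incl_refl D).
  by apply: (derive1 HR (Or32 _ _ (NotL _ _ A))) => //=; exact: rR.
- move=> G D A HX _ /(_ (bss _)) IH b.
  apply: (derivable_absorbR HR HX b).
  by apply: (derive1 HR (Or32 _ _ (NotR _ _ A))) => //=; exact: rL.
- move=> G D A B HX _ IH b; apply: (derivable_absorbL HR HX b).
  by apply: (derive1 HR (Or32 _ _ (AndL1 _ _ A B))) => //=;
    apply: rL => //; exact: IH.
- move=> G D A B HX _ IH b; apply: (derivable_absorbL HR HX b).
  by apply: (derive1 HR (Or32 _ _ (AndL2 _ _ A B))) => //=;
    apply: rL => //; exact: IH.
- move=> G D A B HX _ /(_ (bs _ _)) IHA _ /(_ (bs _ _)) IHB b.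
  apply: (derivable_absorbR HR HX b).
  by apply: (derive2 HR (Or32 _ _ (AndR _ _ A B))) => //=; exact: rR.
- move=> G D A B HX _ IHA _ IHB b; apply: (derivable_absorbL HR HX b).
  apply: (derive2 HR (Or32 _ _ (OrL _ _ A B))) => //=; apply: rL => //.
    exact: IHA.
  exact: IHB.
- move=> G D A B HX _ /(_ (bs _ _)) IH b.
  apply: (derivable_absorbR HR HX b).
  by apply: (derive1 HR (Or32 _ _ (OrR1 _ _ A B))) => //=; exact: rR.
- move=> G D A B HX _ /(_ (bs _ _)) IH b.
  apply: (derivable_absorbR HR HX b).
  by apply: (derive1 HR (Or32 _ _ (OrR2 _ _ A B))) => //=; exact: rR.
- move=> G D A B HX _ /(_ (bs _ _)) IHA _ IHB b.
  apply: (derivable_absorbL HR HX b).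
  have b2 : bounded lj (side lj D ++ D) by case: (lj) b.
  apply: (derivable_incl (G := rcons (G ++ G) (Imp A B))
    (D := side lj D ++ D) HR) => //.
  + by move=> X; rewrite !in_rcons_iff in_cat_iff; tauto.
  + move=> X /in_cat_iff[|//]; exact: (incl_sidel (List.incl_refl D)).
  apply: (derive2 HR (Or32 _ _ (ImpL _ _ _ _ A B))) => //=; first exact: rR.
  by apply: rL => //; exact: IHB.
- move=> G D A B HX _ /(_ (bs _ _)) IH b.
  apply: (derivable_absorbR HR HX b).
  apply: (derive1 HR (Or32 _ _ (ImpR _ _ A B))) => //=.
  by apply: rL => //; exact: rR.
- move=> G D A t HX _ IH b; apply: (derivable_absorbL HR HX b).
  by apply: (derive1 HR (Or32 _ _ (AllL _ _ A t))) => //=;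
    apply: rL => //; exact: IH.
- move=> G D A HX _ IH b; apply: (derivable_absorbR HR HX b).
  have [a [Ha _]] := fresh_variable (G ++ rcons (side lj D) (All A)) [::].
  apply: (derive1 HR (Or32 _ _ (AllR (a := a) _))) => //=.
    by case=> F [HF]; exact: Ha.
  by apply: rR; exact: IH.
- move=> G D A HX _ IH b; apply: (derivable_absorbL HR HX b).
  have [a [Ha _]] := fresh_variable (rcons G (Ex A) ++ D) [::].
  apply: (derive1 HR (Or32 _ _ (ExL (a := a) _))) => //=.
    by case=> F [HF]; exact: Ha.
  by apply: rL => //; exact: IH.
- move=> G D A t HX _ /(_ (bs _ _)) IH b.
  apply: (derivable_absorbR HR HX b).
  by apply: (derive1 HR (Or32 _ _ (ExR _ _ A t))) => //=; exact: rR.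
- move=> G D t HX b.
  apply: (derivable_incl (G := [::]) (D := [:: Eq t t]) HR) => //.
  + by move=> X /= [<-|].
  + by apply: (derive0 HR) => //; apply: Or33; constructor.
- move=> G D r s A B e HAB HX _ /(_ (bs _ _)) IH b.
  apply: (derivable_absorbR HR HX b).
  have [v [Hv Ht]] := fresh_variable [:: A] [:: r; s].
  have [C [EA EB]] := repl_abstract HAB (Hv A (or_introl erefl)).
  have vr := Ht r (or_introl erefl).
  have vs := Ht s (or_intror (or_introl erefl)).
  have {}IH := rR _ _ _ IH; rewrite EA in IH; rewrite EB.
  case: e => He; apply: (derivable_absorbL HR He) => //.
  + exact: (derive1 HR (Or33 _ _ (Eq1 _ _ _ vr vs)) (br _ _) (br _ _)) IH.
  + exact: (derive1 HR (Or33 _ _ (Eq2 _ _ _ vr vs)) (br _ _) (br _ _)) IH.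
Qed.

Theorem theorem1p3 (L : signature) :
  (forall S : sequent L, derivable LJeq S -> derivable cutfree_LJeq S) /\
  (forall S : sequent L, derivable LKeq S -> derivable cutfree_LKeq S).
Proof.
split=> S H.
- have b : bounded true (succ S).
    by case: H => Ps {}S [_ Hb] _ _; apply: Hb; left.
  have := prov_of_derivable (lj := true) _ H FVar.
  rewrite !(eq_map (@fsub_id _ _)) !map_id => HS.
  case: S b {H} HS => G D b HS; apply: (derivable_of_prov (lj := true)) b.
    by move=> Ps S HS' Hb; split=> // T /Hb; apply.
  by apply: HS => Ps S [HS' Hb]; split=> // T /Hb HT _.
- have := prov_of_derivable (lj := false) _ H FVar.
  rewrite !(eq_map (@fsub_id _ _)) !map_id => HS.
  case: S {H} HS => G D HS; apply: (derivable_of_prov (lj := false)) => //.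
  exact: HS.
Qed.
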